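(* Let $G$ be a graph of order $n\geq 2$ which has a Hamiltonian path. Then \[ \lfloor 2n/3 \rfloor +1\leq \chi_d^t(C(G))\leq n+ \lceil n/2 \rceil . \]
   Context: All graphs are finite, simple and undirected. For a graph $G=(V,E)$ with $V=\{v_1,\dots,v_n\}$, the central graph $C(G)$ is the graph with vertex set $V\cup\{c_{ij} : v_iv_j\in E\}$ obtained by subdividing each edge $v_iv_j$ of $G$ exactly once by a new vertex $c_{ij}$ (adjacent to exactly $v_i$ and $v_j$) and joining every pair of distinct vertices non-adjacent in $G$. A total dominator coloring (TDC) of a graph $H$ with no isolated vertices is a proper vertex coloring of $H$ in which every vertex is adjacent to all vertices of some color class. $\chi_d^t(H)$ is the minimum number of color classes in a TDC of $H$. *)

(* Defs.v *)
From HB Require Import structures.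
From mathcomp Require Import all_boot.

Set Implicit Arguments.
Unset Strict Implicit.
Unset Printing Implicit Defensive.

Record sgraph := SGraph {
  vertex :> finType;
  adj : rel vertex;
  adj_sym : symmetric adj;
  adj_irr : irreflexive adj }.

Definition has_hamiltonian_path (G : sgraph) : Prop :=
  exists (x : G) (p : seq G),
    [/\ path (@adj G) x p, uniq (x :: p) & forall v : G, v \in x :: p].

Section Coloring.

Variable H : sgraph.

Definition neighbors (v : H) : {set H} := [set w | adj v w].

Definition no_isolated_vertex : Prop := forall v : H, exists w : H, adj v w.

Definition proper_coloring (C : eqType) (f : H -> C) : bool :=
  [forall v, forall w, adj v w ==> (f v != f w)].

(* The nonempty fibers of f: colors that are not used give no class. *)
Definition color_classes (C : eqType) (f : H -> C) : {set {set H}} :=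
  preim_partition f [set: H].

Definition total_dominator_coloring (C : eqType) (f : H -> C) : bool :=
  proper_coloring f &&
  [forall v, exists A in color_classes f, A \subset neighbors v].

(* No coloring of H has more than #|H| classes, so #|H| colors are enough to  *)
(* realize all of them up to renaming colors. The starting point enum_rank    *)
(* (all vertices colored differently) is a total dominator coloring as soon   *)
(* as H has no isolated vertex, and then the value below is the minimum       *)
(* number of classes, see total_dominator_chromatic_numberP. When H has an    *)
(* isolated vertex there is no such coloring and the value is meaningless.    *)
Definition total_dominator_chromatic_number : nat :=
  #|color_classes
      [arg min_(f < [ffun v => enum_rank v] : {ffun H -> 'I_#|H|}
               | total_dominator_coloring f) #|color_classes f|]|.

Lemma color_classes_eq (C D : eqType) (f : H -> C) (g : H -> D) :
  (forall v w, (f v == f w) = (g v == g w)) ->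
  color_classes f = color_classes g.
Proof.
move=> fg; apply: eq_in_imset => v _ /=.
by apply/setP => w; rewrite !inE fg.
Qed.

Lemma enum_rank_tdc : no_isolated_vertex ->
  total_dominator_coloring ([ffun v => enum_rank v] : {ffun H -> 'I_#|H|}).
Proof.
move=> niso; apply/andP; split.
  apply/forallP => v; apply/forallP => w; apply/implyP => vw.
  rewrite !ffunE (inj_eq enum_rank_inj); apply: contraTneq vw => ->.
  by rewrite adj_irr.
apply/forallP => v; have [w vw] := niso v.
apply/existsP; exists [set w]; rewrite sub1set inE vw andbT.
apply/imsetP; exists w; rewrite ?inE //.
apply/setP => u; rewrite !inE /= !ffunE (inj_eq enum_rank_inj).
by rewrite eq_sym.
Qed.

Lemma total_dominator_chromatic_numberP : no_isolated_vertex ->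
  (exists2 f : H -> 'I_#|H|, total_dominator_coloring f &
     #|color_classes f| = total_dominator_chromatic_number) /\
  (forall (C : eqType) (f : H -> C), total_dominator_coloring f ->
     total_dominator_chromatic_number <= #|color_classes f|).
Proof.
move=> niso; rewrite /total_dominator_chromatic_number.
case: arg_minnP => [|f tf fmin]; first exact: enum_rank_tdc.
split; first by exists f.
move=> C g tg.
pose r v := odflt v [pick w | g w == g v].
have gr v : g (r v) = g v.
  by rewrite /r; case: pickP => [w /eqP|].
have rP v w : g v = g w -> r v = r w.
  rewrite /r => ->; case: pickP => // /(_ w); by rewrite eqxx.
pose h : {ffun H -> 'I_#|H|} := [ffun v => enum_rank (r v)].
have gh v w : (g v == g w) = (h v == h w).
  rewrite !ffunE (inj_eq enum_rank_inj).
  by apply/eqP/eqP => [/rP //|rvw]; rewrite -gr rvw gr.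
rewrite (color_classes_eq gh); apply: fmin.
move: tg; rewrite /total_dominator_coloring (color_classes_eq gh).
congr (_ && _); apply: eq_forallb => v; apply: eq_forallb => w.
by rewrite gh.
Qed.

End Coloring.

Section CentralGraph.

Variable G : sgraph.

Definition edges : {set {set G}} :=
  [set [set p.1; p.2] | p in [set p : G * G | adj p.1 p.2]].

(* inl v is a vertex of G; inr A, with A = {v_i, v_j} an edge, is the vertex  *)
(* c_ij subdividing A.                                                        *)
Definition central_vertex : finType := (G + {A : {set G} | A \in edges})%type.

Definition central_adj : rel central_vertex := fun a b =>
  match a, b with
  | inl v, inl w => (v != w) && ~~ adj v w
  | inl v, inr A => v \in val A
  | inr A, inl v => v \in val A
  | inr _, inr _ => false
  end.

Lemma central_adj_sym : symmetric central_adj.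
Proof. by case=> [v|A] [w|B] //=; rewrite eq_sym adj_sym. Qed.

Lemma central_adj_irr : irreflexive central_adj.
Proof. by case=> [v|A] //=; rewrite eqxx. Qed.

Definition central_graph : sgraph := SGraph central_adj_sym central_adj_irr.

Lemma central_graph_no_isolated_vertex :
  2 <= #|G| -> no_isolated_vertex central_graph.
Proof.
move=> G2 [v|[A eA]].
  have /card_gt0P [w] : 0 < #|[set~ v]| by rewrite cardsC1 -subn1 subn_gt0.
  rewrite !inE => wv; case vw: (adj v w).
    have eA : [set v; w] \in edges.
      by apply/imsetP; exists (v, w); rewrite ?inE.
    by exists (inr (exist (fun A => A \in edges) _ eA)); rewrite /= !inE eqxx.
  by exists (inl w); rewrite /= eq_sym wv vw.
have /imsetP [p _ AE] := eA.
by exists (inl p.1); rewrite /= AE !inE eqxx.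
Qed.

End CentralGraph.

(* Main.v *)
Require Import Defs.
From mathcomp Require Import all_boot.
From mathcomp Require Import zify.

(** In a total dominator coloring f of C(G), the subdivision vertex of an edge
    uw of G is dominated by a class contained in {u, w}.  Hence two adjacent
    vertices of G, neither of which is alone in its class, form a whole class.
    As two vertices of G of the same color are adjacent in G, a class contains
    at most two vertices of G, and at most one if it also contains a
    subdivision vertex ("mixed" class).

    Let s be the number of vertices that are alone in their class, and t the
    number of the other colors of vertices of G, m of which are mixed.  Then
    n <= s + 2t - m, and t <= s + 1 since the color is constant on each run of
    the Hamiltonian path between two of the s vertices.  Either some class has
    only subdivision vertices, so that there are at least s + t + 1 classes, or
    m >= 2: the vertex of G in one mixed class has an incident edge, whose
    subdivision vertex must lie in another mixed class.  Both cases give the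
    lower bound.

    For the upper bound, let v_0, v_1, ... be the Hamiltonian path.  Give v_0
    and v_1 the same color, the other v_i their own colors, own colors to
    ceil(n/2) subdivision vertices of path edges that cover all the v_i, and
    one more color to the remaining subdivision vertices. *)

Set Implicit Arguments.
Unset Strict Implicit.
Unset Printing Implicit Defensive.

(** * Total dominator colorings through colors rather than classes *)

Section Colorings.

Variable H : sgraph.

Lemma total_dominator_coloringP (C : eqType) (f : H -> C) :
  reflect ((forall v w : H, adj v w -> f v != f w) /\
           (forall v : H, exists u : H, forall w, f w = f u -> adj v w))
          (total_dominator_coloring f).
Proof.
apply: (iffP andP) => [[/forallP pf /forallP df]|[pf df]]; split.
- by move=> v w vw; have /forallP/(_ w)/implyP/(_ vw) := pf v.
- move=> v; have /exists_inP [A /imsetP [u _ ->] /subsetP sA] := df v.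
  exists u => w fwu; have := sA w; rewrite !inE fwu eqxx; exact.
- apply/forallP => v; apply/forallP => w; apply/implyP; exact: pf.
- apply/forallP => v; have [u du] := df v; apply/exists_inP.
  exists [set w in [set: H] | f u == f w]; first by apply/imsetP; exists u.
  by apply/subsetP => w; rewrite !inE => /eqP fuw; apply: du.
Qed.

Lemma card_color_classes (C : finType) (f : H -> C) :
  #|color_classes f| = #|f @: [set: H]|.
Proof.
pose fiber c := [set w : H | c == f w].
have -> : color_classes f = fiber @: (f @: [set: H]).
  rewrite -imset_comp; apply: eq_in_imset => v _.
  by apply/setP => w; rewrite !inE.
apply: card_in_imset => _ _ /imsetP [v _ ->] /imsetP [w _ ->].
by move=> /setP /(_ v); rewrite !inE eqxx => /esym /eqP.
Qed.

End Colorings.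

Lemma size_undup_runs (T C : eqType) (e : rel T) (S : pred T) (g : T -> C) x p :
    {in predC S &, forall u w, e u w -> g u = g w} ->
  path e x p ->
  size (undup [seq g u | u <- x :: p & ~~ S u]) <= (count S (x :: p)).+1.
Proof.
(* For the induction, the extra unit is charged only when the path starts outside [S]: a vertex of
   [S] put in front pays for the run behind it. *)
move=> gS; suff strong y q : path e y q ->
    size (undup [seq g u | u <- y :: q & ~~ S u]) <= count S (y :: q) + ~~ S y.
  by move=> /strong /leq_trans; apply; rewrite -addn1 leq_add2l leq_b1.
elim: q y => [|z q IHq] y /=; first by case: (S y).
move=> /andP [eyz /IHq] /=.
case Sy: (S y) => /= le_runs.
  by apply: leq_trans le_runs _; case: (S z) => /=; lia.
case Sz: (S z) le_runs => /= le_runs; first by case: ifP => _ /=; lia.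
have -> : g y = g z by apply: gS; rewrite ?inE ?Sy ?Sz.
by rewrite inE eqxx.
Qed.

Lemma path_neighbor (T : eqType) (e : rel T) x p v :
  symmetric e -> path e x p -> 1 < size (x :: p) -> v \in x :: p ->
  exists w, e v w.
Proof.
move=> e_sym; elim: p x => [|y p IHp] //= x /andP [exy eyp] _.
rewrite inE => /predU1P [->|]; first by exists y.
case: p IHp eyp => [|z p] IHp eyp; last exact: IHp.
by rewrite inE => /eqP ->; exists x; rewrite e_sym.
Qed.

Lemma mem_edges (G : sgraph) (u w : G) : adj u w -> [set u; w] \in edges G.
Proof. by move=> uw; apply/imsetP; exists (u, w); rewrite ?inE. Qed.

Definition subdivision_vertex (G : sgraph) (u w : G) (uw : adj u w) :
    central_graph G :=
  inr (exist (fun A => A \in edges G) _ (mem_edges uw)).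

(** * Lower bound: counting the vertices of [G] by color *)

Section LowerBound.

Variables (G : sgraph) (C : finType) (f : central_graph G -> C).
Hypothesis tdc_f : total_dominator_coloring f.

Let g (v : G) : C := f (inl v).
Let lone : {set G} := [set v | [forall z, (f z == g v) ==> (z == inl v)]].
Let mixed (c : C) := [exists A, f (inr A) == c].

Let f_proper v w : adj v w -> f v != f w.
Proof. by have /total_dominator_coloringP [pf _] := tdc_f; exact: pf. Qed.

Let loneP v : reflect (forall z, f z = g v -> z = inl v) (v \in lone).
Proof.
rewrite inE; apply: (iffP forallP) => vP z.
  by move=> fz; apply/eqP; move: (vP z); rewrite fz eqxx.
by apply/implyP => /eqP /vP ->.
Qed.

Lemma same_color_adj (u w : G) : g u = g w -> u != w -> adj u w.
Proof.
move=> guw uw; apply/negPn/negP => nuw.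
have := @f_proper (inl u) (inl w); rewrite /= uw nuw => /(_ isT).
by rewrite -/(g u) guw eqxx.
Qed.

(** If the class dominating the subdivision vertex of [uw] contained only one of [u] and [w], that
    end would be in [lone]. *)
Lemma adj_not_lone (u w : G) : adj u w -> u \notin lone -> w \notin lone ->
  g u = g w /\ forall z, f z = g u -> z = inl u \/ z = inl w.
Proof.
move=> uw Su Sw; have /total_dominator_coloringP [_ df] := tdc_f.
have [z0 dz0] := df (subdivision_vertex uw).
have class_sub z : f z = f z0 -> z = inl u \/ z = inl w.
  move=> /dz0; case: z => //= v; rewrite !inE.
  by case/orP => /eqP ->; [left | right].
case: (class_sub z0 erefl) => z0E; rewrite z0E in class_sub.
- split=> //; apply/eqP; apply: contraNT Su => guw; apply/loneP => z fz.
  by case: (class_sub z fz) => // zw; rewrite -fz zw eqxx in guw.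
- have guw : g u = g w; last by rewrite guw.
  apply/eqP; apply: contraNT Sw => guw; apply/loneP => z fz.
  by case: (class_sub z fz) => // zu; rewrite -fz zu eqxx in guw.
Qed.

Lemma same_color_class (u w : G) : g u = g w -> u != w ->
  forall z, f z = g u -> z = inl u \/ z = inl w.
Proof.
move=> guw uw; have e_uw := same_color_adj guw uw.
apply: (proj2 (adj_not_lone e_uw _ _)); apply/loneP.
  by move=> /(_ (inl w) (esym guw)) [wu]; rewrite wu eqxx in uw.
by move=> /(_ (inl u) guw) [wu]; rewrite wu eqxx in uw.
Qed.

Lemma card_class_le c : #|[set v | g v == c]| + mixed c <= 2.
Proof.
have [le1|/card_gt1P [u [w []]]] := leqP #|[set v | g v == c]| 1.
  by case: (mixed c); lia.
rewrite !inE => /eqP gu /eqP gw uw.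
have classE := same_color_class (etrans gu (esym gw)) uw.
have -> : mixed c = false.
  apply/existsP => -[A /eqP fA].
  by case: (classE (inr A) (etrans fA (esym gu))).
have sub2 : [set v | g v == c] \subset [set u; w].
  apply/subsetP => v; rewrite !inE => /eqP gv.
  by case: (classE (inl v) (etrans gv (esym gu))) => [[->]|[->]];
    rewrite eqxx ?orbT.
by rewrite addn0 (leq_trans (subset_leq_card sub2)) // cards2; case: eqP.
Qed.

(** Sum [card_class_le] over the colors in [g @: ~: lone]. *)
Lemma card_not_lone_le :
  #|~: lone| + #|[set c in g @: ~: lone | mixed c]| <= 2 * #|g @: ~: lone|.
Proof.
rewrite -sum1_card (partition_big_imset g) /= -[X in _ + X]sum1_card.
under [X in _ + X]eq_bigl do rewrite inE.
rewrite big_mkcondr -big_split mulnC -sum_nat_const; apply: leq_sum => c _ /=.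
apply: leq_trans (card_class_le c).
rewrite leq_add // sum1dep_card subset_leq_card //.
by apply/subsetP => v; rewrite !inE => /andP [].
Qed.

Lemma card_colors_G : #|g @: [set: G]| = #|lone| + #|g @: ~: lone|.
Proof.
have g_inj : {in lone &, injective g}.
  by move=> u w _ /loneP wP guw; case: (wP (inl u) guw).
rewrite -(card_in_imset g_inj) -cardsUI -imsetU setUCr.
suff -> : (g @: lone) :&: (g @: ~: lone) = set0 by rewrite cards0 addn0.
apply/setP => c; rewrite !inE; apply/andP => -[/imsetP [u uS ->] /imsetP [w]].
rewrite inE => wS guw; have /loneP uP := uS.
by case: (uP (inl w) (esym guw)) => wu; rewrite wu uS in wS.
Qed.

Lemma card_runs_le : has_hamiltonian_path G -> #|g @: ~: lone| <= #|lone|.+1.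
Proof.
move=> [x [p [e_p uniq_p mem_p]]].
have run_const : {in predC (mem lone) &, forall u w, adj u w -> g u = g w}.
  by move=> u w Su Sw uw; case: (adj_not_lone uw Su Sw).
have := size_undup_runs run_const e_p.
have -> : count (mem lone) (x :: p) = #|lone|.
  rewrite -size_filter -(card_uniqP (filter_uniq _ uniq_p)).
  by apply: eq_card => v; rewrite mem_filter mem_p andbT.
apply: leq_trans; rewrite -(card_uniqP (undup_uniq _)) subset_leq_card //.
apply/subsetP => _ /imsetP [v Sv ->]; rewrite mem_undup map_f //.
by rewrite mem_filter mem_p andbT; rewrite inE in Sv.
Qed.

Lemma two_mixed_colors :
    1 < #|G| -> has_hamiltonian_path G ->
    f @: [set: central_graph G] \subset g @: [set: G] ->
  1 < #|[set c in g @: ~: lone | mixed c]|.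
Proof.
move=> G2 [x [p [e_p uniq_p mem_p]]] sub_g.
have mixed_vertex A : exists2 v, g v = f (inr A) & v \notin lone.
  have /imsetP [v _ fAv] := subsetP sub_g _ (imset_f f (in_setT (inr A))).
  by exists v => //; apply/loneP => /(_ (inr A) fAv).
have mixed_color A : f (inr A) \in [set c in g @: ~: lone | mixed c].
  have [v gv Sv] := mixed_vertex A; rewrite inE -gv imset_f ?in_setC //.
  by apply/existsP; exists A; rewrite gv.
have neighbor (u : G) : exists w, adj u w.
  apply: path_neighbor (@adj_sym G) e_p _ (mem_p u).
  rewrite -(card_uniqP uniq_p) (leq_trans G2) // subset_leq_card //.
  by apply/subsetP => w _; exact: mem_p.
have [y xy] := neighbor x.
(* The color of [v] is mixed, being that of the subdivision vertex of [xy]. The subdivision vertex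
   of [vw] is adjacent to [v], so its color is a second mixed one. *)
have [v gv _] := mixed_vertex (exist (fun A => A \in edges G) _ (mem_edges xy)).
have [w vw] := neighbor v.
apply/card_gt1P; exists (f (subdivision_vertex vw)), (g v).
split; [exact: mixed_color | by rewrite gv mixed_color |].
by apply: f_proper; rewrite /= !inE eqxx.
Qed.

Lemma tdc_lower_bound :
  1 < #|G| -> has_hamiltonian_path G ->
  (2 * #|G|) %/ 3 + 1 <= #|color_classes f|.
Proof.
move=> G2 ham_G; rewrite card_color_classes.
have sub_f : g @: [set: G] \subset f @: [set: central_graph G].
  by apply/subsetP => _ /imsetP [v _ ->]; apply/imsetP; exists (inl v).
have le_n := card_not_lone_le; have le_t := card_runs_le ham_G.
have eq_g := card_colors_G; have eq_n := cardsC lone.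
case: (boolP (f @: [set: central_graph G] \subset g @: [set: G])) => sub_g.
  (* With [m >= 2] and [t <= s + 1]: [2n <= 2s + 4t - 4 <= 3(s + t) - 3]. *)
  have := two_mixed_colors G2 ham_G sub_g.
  by have := subset_leq_card sub_f; lia.
(* Here [2n <= 2s + 4t <= 3(s + t) + 1], and there are at least [s + t + 1] colors. *)
by have /proper_card := introT andP (conj sub_f sub_g); lia.
Qed.

End LowerBound.

(** * Upper bound: a coloring built along the Hamiltonian path *)

Section UpperBound.

Variables (G : sgraph) (x : G) (p : seq G).
Hypotheses (G2 : 1 < #|G|) (e_p : path (@adj G) x p) (uniq_p : uniq (x :: p)).
Hypothesis mem_p : forall v : G, v \in x :: p.

Let n := #|G|.
Let s := x :: p.

Let size_s : size s = n.
Proof.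
rewrite -(card_uniqP uniq_p); apply: eq_card => v; exact: mem_p.
Qed.

Let index_lt (v : G) : index v s < n.
Proof. by rewrite -size_s index_mem mem_p. Qed.

Let n_pred_gt0 : 0 < n.-1. Proof. by rewrite /n; lia. Qed.

(* The vertices of indices 0 and 1 both get 0, by truncation. *)
Definition path_color (v : G) : 'I_n.-1 :=
  insubd (Ordinal n_pred_gt0) (index v s).-1.

(* The edges {v_{2k}, v_{2k+1}} of the path, except that the last one is
   {v_{n-2}, v_{n-1}} when n is odd. *)
Definition cover_start (k : nat) := minn k.*2 n.-2.
Definition cover_edge (k : nat) : {set G} :=
  [set nth x s (cover_start k); nth x s (cover_start k).+1].

(** [None] is the color shared by the subdivision vertices off the cover. The sum type keeps the
    colors of [G] apart from theirs. *)
Definition cover_coloring (z : central_graph G) :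
    'I_n.-1 + option 'I_(uphalf n) :=
  match z with
  | inl v => inl (path_color v)
  | inr A => inr [pick k : 'I_(uphalf n) | val A == cover_edge k]
  end.

Let val_path_color v : path_color v = (index v s).-1 :> nat.
(* The default of [insubd] is never reached, as the index is below [n]. *)
Proof. by rewrite val_insubd; have := index_lt v; case: ifP; lia. Qed.

Let adj_nth i : i.+1 < n -> adj (nth x s i) (nth x s i.+1).
Proof. by rewrite -size_s ltnS => lt_i; apply: (pathP x e_p). Qed.

Let path_color_eq u w : path_color u = path_color w ->
  u = w \/ (index u s <= 1) && (index w s <= 1).
Proof.
move=> /(congr1 (@nat_of_ord _)); rewrite !val_path_color => uw.
have [iuw|iuw] := eqVneq (index u s) (index w s); last by right; lia.
by left; rewrite -(nth_index x (mem_p u)) iuw nth_index.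
Qed.

Let vertex_index_le1 u : index u s <= 1 -> u = nth x s 0 \/ u = nth x s 1.
Proof.
rewrite -{2 3}(nth_index x (mem_p u)).
by case: (index u s) => [|[|]] // _; [left | right].
Qed.

Lemma path_color_proper u w : path_color u = path_color w -> u = w \/ adj u w.
Proof.
move=> /path_color_eq [|/andP []]; first by left.
have e01 := adj_nth G2.
by move=> /vertex_index_le1 [] -> /vertex_index_le1 [] ->;
  [left | right | right; rewrite adj_sym | left].
Qed.

Lemma cover_coloring_tdc : total_dominator_coloring cover_coloring.
Proof.
apply/total_dominator_coloringP; split.
  move=> [v|A] [w|B] //= /andP [vw nvw].
  apply: contraNneq nvw => -[/path_color_proper [/eqP|]] //.
  by rewrite (negPf vw).
move=> [v|[A eA]].
- pose i := index v s; have i_lt : i < n := index_lt v.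
  have k_lt : i./2 < uphalf n by lia.
  have start_lt : (cover_start i./2).+1 < n.
    by rewrite /cover_start; move: G2; rewrite -/n; lia.
  have v_in : v \in cover_edge i./2.
    (* The cap [n.-2] acts only for [i = n - 1] even, and makes [v] the second end. *)
    have [iE|iE] : i = cover_start i./2 \/ i = (cover_start i./2).+1.
    - by rewrite /cover_start; lia.
    - by rewrite !inE -iE nth_index ?eqxx.
    - by rewrite !inE -iE nth_index ?eqxx ?orbT.
  have e_start := adj_nth start_lt.
  exists (subdivision_vertex e_start) => -[w|B] //= [].
  (* A color [Some k] determines the edge; [None] is excluded because [i./2] is a candidate. *)
  case: pickP => [k /eqP ->|_]; case: pickP => [k' /eqP cover_k'|no_k] //.
    by move=> [->]; rewrite -cover_k'.
  by have := no_k (Ordinal k_lt); rewrite eqxx.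
- have /imsetP [[u w]] := eA; rewrite inE /= => uw AE.
  (* An end of index above 1 is a class by itself. Otherwise [A] consists of the vertices of indices
     0 and 1, which form a class. *)
  have dominated v : v \in A -> 1 < index v s ->
      exists u0, forall z, cover_coloring z = cover_coloring u0 ->
        central_adj (inr (exist (fun A => A \in edges G) A eA)) z.
    move=> vA v_gt1; exists (inl v) => -[v'|B] //= [/path_color_eq [->|]] //.
    by lia.
  have [/dominated|u_le] := ltnP 1 (index u s).
    by apply; rewrite AE !inE eqxx.
  have [/dominated|w_le] := ltnP 1 (index w s).
    by apply; rewrite AE !inE eqxx orbT.
  exists (inl u) => -[v|B] //= [/path_color_eq [->|/andP [v_le _]]].
    by rewrite AE !inE eqxx.
  rewrite AE !inE; move: uw.
  by case: (vertex_index_le1 u_le)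
    (vertex_index_le1 w_le) (vertex_index_le1 v_le) => -> [] -> [] ->;
    rewrite ?adj_irr ?eqxx ?orbT.
Qed.

Lemma card_cover_coloring_classes :
  #|color_classes cover_coloring| <= n + uphalf n.
Proof.
rewrite card_color_classes (leq_trans (max_card _)) //.
by rewrite card_sum card_option !card_ord; move: n_pred_gt0; lia.
Qed.

End UpperBound.

Theorem theorem2p2 (G : sgraph) (n : nat) (order_G : #|G| = n) (n_ge2 : 2 <= n)
    (ham_G : has_hamiltonian_path G) :
  (2 * n) %/ 3 + 1 <= total_dominator_chromatic_number (central_graph G)
  /\ total_dominator_chromatic_number (central_graph G) <= n + uphalf n.
Proof.
subst n.
have [[f tdc_f <-] le_chi] :=
  total_dominator_chromatic_numberP (central_graph_no_isolated_vertex n_ge2).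
split; first exact: tdc_lower_bound.
have [x [p [e_p uniq_p mem_p]]] := ham_G.
apply: leq_trans (le_chi _ _ (cover_coloring_tdc n_ge2 e_p uniq_p mem_p)) _.
exact: card_cover_coloring_classes.
Qed.
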